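(* Let $(X,\tau)$ be a compact topological space. Then $(X,{}^{*}O(X))$ is a compact space.
   Context: For a topological space $(X,\tau)$, a set $U\subseteq X$ is called regular open if $\mathrm{int}(\mathrm{cl}(U))=U$; the collection of all regular open subsets is denoted $R.O(X)$. A set $A\subseteq X$ is called $*$-open if for every $x\in A$ there exists $U\in R.O(X)$ with $x\in U\subseteq A$. The collection of all $*$-open subsets of $(X,\tau)$ is denoted ${}^{*}O(X)$; it is a topology on $X$. Compact means every open cover has a finite subcover (no separation axiom assumed). *)

(* Defs.v *)
From HB Require Import structures.
From mathcomp Require Import all_boot all_order all_algebra.
From mathcomp Require Import all_classical.
From mathcomp Require Export topology_structure compact.

Set Implicit Arguments.
Unset Strict Implicit.
Unset Printing Implicit Defensive.

Local Open Scope classical_set_scope.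

Definition star_open (T : topologicalType) : set_system T :=
  [set A | forall x, A x -> exists U, [/\ regopen U, U x & U `<=` A]].

(* The carrier of T, retopologized by its *-open sets: the canonical topology
   found on [star_topology T] is star_open T, not the one of T. *)
Definition star_topology (T : topologicalType) : Type := T.

Section StarTopology.
Variable T : topologicalType.
Implicit Types U V : set T.

Lemma regopenT : regopen [set: T].
Proof. by rewrite /regopen closureT interiorT. Qed.

Lemma regopen_open U : regopen U -> open U.
Proof. by move=> <-; exact: open_interior. Qed.

Lemma regopenI U V : regopen U -> regopen V -> regopen (U `&` V).
Proof.
move=> rU rV; rewrite /regopen eqEsubset; split.
  by rewrite -{2}rU -{2}rV subsetI; split; apply: interiorS; apply: closureS;
    [exact: subIsetl|exact: subIsetr].
rewrite -open_subsetE; first exact: subset_closure.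
by apply: openI; exact: regopen_open.
Qed.

Lemma star_openT : star_open [set: T].
Proof. by move=> x _; exists setT; split=> //; exact: regopenT. Qed.

Lemma star_openI : setI_closed (@star_open T).
Proof.
move=> A B sA sB x [/sA[U [rU Ux UA]] /sB[V [rV Vx VB]]].
by exists (U `&` V); split; [exact: regopenI| |exact: setISS].
Qed.

Lemma star_open_bigU (I : Type) (f : I -> set T) :
  (forall i, star_open (f i)) -> star_open (\bigcup_i f i).
Proof.
move=> sf x [i _ /(sf i)[U [rU Ux Uf]]].
by exists U; split=> // y /Uf fy; exists i.
Qed.

HB.instance Definition _ := Choice.copy (star_topology T) T.
HB.instance Definition _ := isOpenTopological.Build (star_topology T)
  star_openT star_openI star_open_bigU.

Lemma star_topology_openE :
  (open : set_system (star_topology T)) = @star_open T.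
Proof. by []. Qed.

End StarTopology.

(* Main.v *)
Require Import Defs.
From mathcomp Require Import all_boot all_classical.

Local Open Scope classical_set_scope.

(** Regular open sets are open, so the *-open topology is coarser than the original one
    ([star_open_open]), and compactness passes to any coarser topology on the same set. *)

Lemma star_open_open (T : topologicalType) (A : set T) : star_open A -> open A.
Proof.
move=> sA; rewrite openE => x /sA[U [rU Ux UA]].
exact: interiorS UA x (open_nbhs_nbhs (conj (regopen_open rU) Ux)).
Qed.

Theorem lemma18 (T : topologicalType) :
  cover_compact [set: T] -> cover_compact [set: star_topology T].
Proof.
(* [star_topology T] unfolds to [T], so the same family is a cover of [T] and its finite subcover
   serves unchanged; only the openness of its members has to be transferred. *)
move=> cT I D f fo; apply: (cT I D f) => i /fo.
exact: star_open_open.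
Qed.
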